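(* Let $N=pd$ with $p,d$ positive integers and let $q_1,\dots,q_K$ be all the positive divisors of $N$. For each $i\in\{1,\dots,K\}$ let $L_i\subset\{0,1,\dots,d-1\}$, and define $$\widetilde S_{p,q_i}:=\operatorname{span}\{L_{pk}c_{q_i}:k\in\{0,\dots,d-1\}\setminus L_i\}.$$ (a) Single erasure case: assume $\#L_i\le1$ for all $i$. (i) If $p=1$ and $N\ge2$, then $\{\widetilde S_{1,q_i}\}_{i=1}^K$ is a fusion frame for $\ell^2(\mathbb Z_N)$. (ii) If $p=2$, $N\ge2$, and $d$ is odd, then $\{\widetilde S_{2,q_i}\}_{i=1}^K$ is a fusion frame for $\ell^2(\mathbb Z_N)$. (b) Double erasure case: assume $\#L_i\le2$ for all $i$. (i) If $p=1$ and $N-1\ge2\phi(N)$, then $\{\widetilde S_{1,q_i}\}_{i=1}^K$ is a fusion frame for $\ell^2(\mathbb Z_N)$. (ii) If $p=2$, $d$ is odd, and $d-1\ge2\phi(N)$, then $\{\widetilde S_{2,q_i}\}_{i=1}^K$ is a fusion frame for $\ell^2(\mathbb Z_N)$. Moreover, in all the cases above (with the respective value of $p$), for each $i$ the collection $\{L_{pk}c_{q_i}\}_{k\in\{0,\dots,d-1\}\setminus L_i}$ is a frame for $S_{p,q_i}$, and the associated fusion frame bounds are given by $$\frac{\min_{1\le i\le K}A_{p,i}}{p\,d^2}\qquad\text{and}\qquad1,$$ where $A_{p,i}$ denotes the lower frame bound of $\{L_{pk}c_{q_i}\}_{k\in\{0,\dots,d-1\}\setminus L_i}$.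
   Context: $\ell^2(\mathbb Z_N)$ is the $N$-dimensional complex Hilbert space of functions on $\mathbb Z_N=\{0,1,\dots,N-1\}$ (identified with $N$-periodic functions on $\mathbb Z$), with $\langle x,y\rangle=\sum_{n=0}^{N-1}x(n)\overline{y(n)}$. For $m\in\mathbb Z$, the circular shift is $L_mx(n)=x(n-m)$ (the operators $L_{pk}$ are not to be confused with the index sets $L_i$). For a positive integer $q$, the $q$-th Ramanujan sum is $c_q(n)=\sum_{1\le k\le q,\,(k,q)=1}e^{2\pi i kn/q}$; it is $q$-periodic, so for $q\mid N$ it is regarded as an element of $\ell^2(\mathbb Z_N)$. $\phi$ is Euler's totient function, $\#$ denotes cardinality, and $S_{p,q_i}:=\operatorname{span}\{L_{pk}c_{q_i}:0\le k\le\phi(q_i)-1\}$. A finite family $(f_j)$ in a finite-dimensional Hilbert space $H$ is a frame for $H$ with lower and upper frame bounds $A,B>0$ if $A\|x\|^2\le\sum_j|\langle x,f_j\rangle|^2\le B\|x\|^2$ for all $x\in H$. A family of subspaces $\{W_i\}_{i=1}^K$ of $\ell^2(\mathbb Z_N)$ (with all weights equal to 1) is a fusion frame for $\ell^2(\mathbb Z_N)$ with lower and upper fusion frame bounds $0<A\le B<\infty$ if $A\|x\|^2\le\sum_{i=1}^K\|P_{W_i}x\|^2\le B\|x\|^2$ for all $x\in\ell^2(\mathbb Z_N)$, where $P_W$ is the orthogonal projection onto $W$.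
   Formalization: In case (a)(ii) it is additionally assumed that no L_i is all of {0,…,d−1}; this only matters for d=1, N=2, where erasing the single vector makes a span zero and the claim false. *)

(* Defs.v *)
From mathcomp Require Import all_boot all_order all_algebra.
From mathcomp Require Import sesquilinear spectral complex.
From mathcomp Require Import reals trigo.
Set Implicit Arguments.
Unset Strict Implicit.
Unset Printing Implicit Defensive.

Import Order.TTheory GRing.Theory Num.Theory.
Local Open Scope ring_scope.
Local Open Scope complex_scope.

(* Vectors of l^2(Z_N) are row vectors x : 'rV[R[i]]_N, with x(n) = x 0 n.
   MathComp's [dotmx x y] is \sum_n x(n) * (y(n))^*.  Subspaces are given as
   row spaces of matrices, with membership (x <= W)%MS; the orthogonal
   projection of x onto W is x *m proj_ortho W. *)

Definition sqnorm (R : realType) (N : nat) (x : 'rV[R[i]]_N) : R[i] :=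
  dotmx x x.

(* (n - m) mod N, as an index; [insubd n] only supplies the bound proof, since
   the remainder is always < N when 'I_N is inhabited. *)
Definition cshift_index (N : nat) (m : int) (n : 'I_N) : 'I_N :=
  insubd n `|((n%:Z - m) %% N%:Z)%Z|%N.

Definition cshift (R : realType) (N : nat) (m : int) (x : 'rV[R[i]]_N) :
    'rV[R[i]]_N :=
  \row_(n < N) x 0 (cshift_index m n).

Definition expi (R : realType) (t : R) : R[i] := cos t +i* sin t.

Definition ramanujan (R : realType) (q n : nat) : R[i] :=
  \sum_(1 <= k < q.+1 | coprime k q) expi (2 * pi * (k * n)%:R / q%:R).

Definition ramanujan_vec (R : realType) (N q : nat) : 'rV[R[i]]_N :=
  \row_(n < N) ramanujan R q n.

(* L_{pk} c_q *)
Definition shifted_ramanujan (R : realType) (N p q k : nat) : 'rV[R[i]]_N :=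
  cshift (p * k)%N%:Z (ramanujan_vec R N q).

Definition family_span (R : realType) (N : nat) (I : finType) (D : {set I})
    (f : I -> 'rV[R[i]]_N) : 'M[R[i]]_N :=
  (\sum_(k in D) <<f k>>)%MS.

(* S_{p,q} *)
Definition ramanujan_space (R : realType) (N p q : nat) : 'M[R[i]]_N :=
  family_span [set: 'I_(totient q)] (fun k => shifted_ramanujan R N p q k).

(* The span with the shifts indexed by L erased: \tilde S_{p,q} *)
Definition erased_ramanujan_space (R : realType) (N p d q : nat)
    (L : {set 'I_d}) : 'M[R[i]]_N :=
  family_span (~: L) (fun k => shifted_ramanujan R N p q k).

Section Frames.
Variables (R : realType) (N : nat).

Section Frame.
Variables (H : 'M[R[i]]_N) (I : finType) (D : {set I}) (f : I -> 'rV[R[i]]_N).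

Definition lower_frame_bound (A : R) : Prop :=
  0 < A /\ forall x : 'rV[R[i]]_N, (x <= H)%MS ->
    A%:C * sqnorm x <= \sum_(j in D) `|dotmx x (f j)| ^+ 2.

Definition upper_frame_bound (B : R) : Prop :=
  0 < B /\ forall x : 'rV[R[i]]_N, (x <= H)%MS ->
    \sum_(j in D) `|dotmx x (f j)| ^+ 2 <= B%:C * sqnorm x.

Definition is_frame : Prop :=
  (forall j, j \in D -> (f j <= H)%MS) /\
  exists A B : R, lower_frame_bound A /\ upper_frame_bound B.

End Frame.

Definition fusion_frame_bounds (K : nat) (W : 'I_K -> 'M[R[i]]_N) (A B : R) :
    Prop :=
  0 < A <= B /\ forall x : 'rV[R[i]]_N,
    A%:C * sqnorm x <= \sum_(i < K) sqnorm (x *m proj_ortho (W i))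
                    <= B%:C * sqnorm x.

Definition is_fusion_frame (K : nat) (W : 'I_K -> 'M[R[i]]_N) : Prop :=
  exists A B : R, fusion_frame_bounds W A B.

End Frames.

(* Main.v *)
(* Write e_j(n) = w^(jn) with w = exp(2 pi i / N), and J_q (freqs N q) for the
   frequencies j with gcd(j, N) = N / q. Then c_q is the sum of the e_j with j
   in J_q, so that <x, L_(pk) c_q> is the trigonometric sum over J_q with
   coefficients <x, e_j>, evaluated at k for the d-th root of unity w^p. For the
   given p the elements of J_q are distinct modulo d, and Parseval on Z_d makes
   the full family tight with bound N d = p d^2. After the erasure, a nonzero
   such sum cannot be supported on L_i, because one or two consecutive residues
   modulo d lie outside J_q; hence the erased family still spans span {e_j : j
   in J_q}. These spaces, for q dividing N, are orthogonal with sum l^2(Z_N), so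
   that the squared norms of the projections add up to ||x||^2. *)
Require Import Defs.
From mathcomp Require Import all_boot all_order all_algebra.
From mathcomp Require Import sesquilinear spectral complex.
From mathcomp Require Import reals trigo.
From mathcomp Require Import ring lra zify.

Set Implicit Arguments.
Unset Strict Implicit.
Unset Printing Implicit Defensive.

Import Order.TTheory GRing.Theory Num.Theory.
Local Open Scope ring_scope.
Local Open Scope sesquilinear_scope.

(** * Complex exponentials and primitive roots of unity *)

Lemma expiD (R : realType) (s t : R) : expi (s + t) = expi s * expi t.
Proof.
rewrite /expi cosD sinD; apply/eqP; rewrite eq_complex /=.
by apply/andP; split; apply/eqP; ring.
Qed.

Lemma expi0 (R : realType) : expi (0 : R) = 1.
Proof. by rewrite /expi cos0 sin0. Qed.

Lemma expiMn (R : realType) (t : R) (n : nat) : expi (t *+ n) = expi t ^+ n.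
Proof.
elim: n => [|n IHn]; first by rewrite mulr0n expi0.
by rewrite mulrS exprS expiD IHn.
Qed.

(** By the half-angle formula, cos t = 1 would force sin (t / 2) = 0, but t / 2 lies strictly
    between 0 and pi. *)
Lemma expi_neq1 (R : realType) (t : R) : 0 < t < 2 * pi -> expi t != 1.
Proof.
move=> /andP[t_gt0 t_lt]; apply/eqP => /(congr1 (@complex.Re R)) /= ct.
have st : 0 < sin (t / 2) by apply: sin_gt0_pi; apply/andP; split; lra.
have : cos ((t / 2) *+ 2) = 1 by rewrite -mulr_natr divfK ?pnatr_eq0.
rewrite cos_mulr2n => c2; have /eqP : sin (t / 2) ^+ 2 = 0.
  by have := cos2Dsin2 (t / 2); lra.
by rewrite sqrf_eq0 gt_eqF.
Qed.

Definition unity_root (R : realType) (N : nat) : R[i] := expi (2 * pi / N%:R).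

Lemma unity_root_prim (R : realType) (N : nat) :
  (0 < N)%N -> N.-primitive_root (unity_root R N).
Proof.
rewrite /unity_root => N_gt0; have N0 : (0 : R) < N%:R by rewrite ltr0n.
have e1 : expi (2 * pi / N%:R : R) ^+ N = 1.
  rewrite -expiMn -[_ *+ N]mulr_natr divfK ?gt_eqF // mulr_natl /expi.
  by rewrite cos2pi sin2pi.
apply/andP; split=> //; apply/forallP => i; rewrite unity_rootE; apply/eqP.
have [->|iN] := eqVneq i.+1 N; first by rewrite e1 eqxx.
apply/negbTE; rewrite -expiMn; apply: expi_neq1.
have iN' : (i.+1 < N)%N by rewrite ltn_neqAle iN ltn_ord.
have pp := pi_gt0 R.
rewrite -[_ *+ i.+1]mulr_natr mulr_gt0 ?ltr0n //=; last by rewrite divr_gt0 // mulr_gt0.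
by rewrite mulrAC ltr_pdivrMr // ltr_pM2l ?ltr_nat // mulr_gt0.
Qed.

(* Let z be a primitive n-th root of unity.
   A trigonometric sum g on Z_n with frequencies in J and supported on L satisfies
   \sum_(k in L) g k * z ^- (k * m) = 0 for each m outside J.  One such m forces
   g = 0 when L is a point, and two consecutive ones do when L is a pair. *)
Definition uniqueness_gap (I : finType) (J : {set I}) (e : I -> nat) (n : nat)
    (L : {set 'I_n}) : Prop :=
  L = set0 \/ exists m, {in J, forall i, e i != m %[mod n]} /\
    ((#|L| <= 1)%N \/
     (#|L| <= 2)%N /\ {in J, forall i, e i != m.+1 %[mod n]}).

(** * Trigonometric sums on Z_n *)

Section RootsOfUnity.
Variables (C : numClosedFieldType) (n : nat) (z : C).
Hypothesis prim_z : n.-primitive_root z.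

Lemma prim_root_norm : `|z| = 1.
Proof.
have n_gt0 := prim_order_gt0 prim_z.
apply: (@pexpIrn _ n) => //; rewrite ?nnegrE //.
by rewrite -normrX prim_expr_order // normr1 expr1n.
Qed.

Lemma prim_root_neq0 : z != 0.
Proof. by rewrite -normr_gt0 prim_root_norm. Qed.

Lemma prim_root_conj : z^* = z^-1.
Proof. by rewrite invC_norm prim_root_norm expr1n invr1 mul1r. Qed.

(** A geometric sum whose ratio u satisfies u^n = 1: either u = 1, or (u - 1) times the sum is u^n -
    1 = 0. *)
Lemma sum_prim_root (a b : nat) :
  \sum_(k < n) z ^+ (k * a) * z^-1 ^+ (k * b) = (n * (a == b %[mod n]))%:R.
Proof.
have z0 := prim_root_neq0.
transitivity (\sum_(k < n) (z ^+ a * z^-1 ^+ b) ^+ k).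
  by apply: eq_bigr => k _; rewrite exprMn -!exprM ![(k * _)%N]mulnC.
set u := z ^+ a * _.
have uE : (u == 1) = (a == b %[mod n]).
  have zb0 : z ^+ b != 0 by rewrite expf_neq0.
  by rewrite -(eq_prim_root_expr prim_z) -(inj_eq (mulIf zb0)) /u exprVn divfK ?mul1r.
rewrite -uE; have [->|u1] := eqVneq u 1.
  by rewrite muln1 (eq_bigr (fun=> 1)) ?sumr_const ?card_ord // => i _; rewrite expr1n.
apply/eqP; rewrite muln0 -(inj_eq (mulfI (_ : u - 1 != 0))) ?subr_eq0 // -subrX1 mulr0.
rewrite /u exprVn exprMn exprVn -!exprM [(a * n)%N]mulnC [(b * n)%N]mulnC !exprM.
by rewrite (prim_expr_order prim_z) !expr1n invr1 mulr1 subrr.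
Qed.

(** Parseval: after expanding the square, orthogonality leaves the diagonal only, since the
    frequencies are distinct modulo n. *)
Lemma sum_prim_root_sqnorm (I : finType) (J : {set I}) (e : I -> nat) (b : I -> C) :
    {in J &, forall i j, e i = e j %[mod n] -> i = j} ->
  \sum_(k < n) `|\sum_(i in J) b i * z ^+ (k * e i)| ^+ 2 =
  n%:R * \sum_(i in J) `|b i| ^+ 2.
Proof.
move=> e_inj.
transitivity (\sum_(k < n) \sum_(i in J) \sum_(j in J)
    b i * (b j)^* * (z ^+ (k * e i) * z^-1 ^+ (k * e j))).
  apply: eq_bigr => k _; rewrite normCK rmorph_sum /= mulr_suml.
  apply: eq_bigr => i _; rewrite mulr_sumr; apply: eq_bigr => j _.
  by rewrite rmorphM rmorphXn /= prim_root_conj mulrACA.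
rewrite exchange_big mulr_sumr; apply: eq_bigr => i Ji.
rewrite exchange_big (bigD1 i) //= [X in _ + X]big1 ?addr0.
  by rewrite -mulr_sumr sum_prim_root eqxx muln1 normCK mulrC.
move=> j /andP[Jj ji]; rewrite -mulr_sumr sum_prim_root.
case: eqP => [/(e_inj _ _ Ji Jj) ij|_]; last by rewrite muln0 mulr0.
by rewrite ij eqxx in ji.
Qed.

Lemma sum_prim_root_dual (I : finType) (J : {set I}) (e : I -> nat) (b : I -> C)
    (m : nat) :
    {in J, forall i, e i != m %[mod n]} ->
  \sum_(k < n) (\sum_(i in J) b i * z ^+ (k * e i)) * z^-1 ^+ (k * m) = 0.
Proof.
move=> mJ.
transitivity (\sum_(i in J) \sum_(k < n) b i * (z ^+ (k * e i) * z^-1 ^+ (k * m))).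
  rewrite exchange_big; apply: eq_bigr => k _; rewrite mulr_suml.
  by apply: eq_bigr => i _; rewrite mulrA.
apply: big1 => i Ji; rewrite -mulr_sumr sum_prim_root.
by rewrite (negbTE (mJ i Ji)) muln0 mulr0.
Qed.

Lemma trig_sum_eq0 (I : finType) (J : {set I}) (e : I -> nat) (b : I -> C)
    (L : {set 'I_n}) :
    {in J &, forall i j, e i = e j %[mod n] -> i = j} ->
    uniqueness_gap J e L ->
    (forall k, k \notin L -> \sum_(i in J) b i * z ^+ (k * e i) = 0) ->
  {in J, forall i, b i = 0}.
Proof.
pose g (k : 'I_n) := \sum_(i in J) b i * z ^+ (k * e i).
move=> e_inj gapL gL; have {}gL k : k \notin L -> g k = 0 by apply: gL.
have n0 : n%:R != 0 :> C by rewrite pnatr_eq0 -lt0n (prim_order_gt0 prim_z).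
have zV0 k : z^-1 ^+ k != 0 by rewrite expf_neq0 // invr_eq0 prim_root_neq0.
(* Once g vanishes everywhere, Parseval makes all the coefficients vanish. *)
suff g0 k : g k = 0.
  have := sum_prim_root_sqnorm b e_inj.
  rewrite big1 => [|k _]; last by rewrite -/(g k) g0 normr0 expr0n.
  move/esym/eqP; rewrite mulf_eq0 (negbTE n0) /= psumr_eq0 => [/allP b0 i Ji|i _].
    by have := b0 i (mem_index_enum _); rewrite Ji sqrf_eq0 normr_eq0 => /eqP.
  exact: exprn_ge0.
case: gapL => [L0|[m [mJ card_L]]]; first by apply: gL; rewrite L0 inE.
have dual m' : {in J, forall i, e i != m' %[mod n]} ->
    \sum_(k in L) g k * z^-1 ^+ (k * m') = 0.
  move=> /(sum_prim_root_dual b); rewrite (bigID (mem L)) /=.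
  by rewrite [X in _ + X]big1 ?addr0 // => j Lj; rewrite -/(g j) gL ?mul0r.
have [Lk|/gL//] := boolP (k \in L).
have [L1|[L2 mJ1]] : (#|L| <= 1)%N \/
  #|L| = 2 /\ {in J, forall i, e i != m.+1 %[mod n]}.
- case: card_L => [|[]]; first by left.
  by rewrite leq_eqVlt => /orP[/eqP ->|]; [right | left].
- have /eqP/cards1P[l LE] : #|L| = 1%N.
    by apply/eqP; rewrite eqn_leq L1; apply/card_gt0P; exists k.
  have := dual m mJ; rewrite LE big_set1 => /eqP.
  move: Lk; rewrite LE inE => /eqP ->.
  by rewrite mulf_eq0 (negbTE (zV0 _)) orbF => /eqP.
have [l kl LE] : exists2 l, l != k & L = [set k; l].
  have /cards1P[l LE] : #|L :\ k| == 1%N.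
    by have := cardsD1 k L; rewrite L2 Lk => /eqP; rewrite eqSS eq_sym.
  have : l \in L :\ k by rewrite LE inE.
  by rewrite !inE => /andP[lk _]; exists l; rewrite // -(setD1K Lk) LE.
have := dual m mJ; have := dual m.+1 mJ1.
rewrite LE !big_setU1 ?inE 1?eq_sym //= !big_set1 !mulnS !exprD => d1 d0.
(* Subtracting z^-l times the relation at m from the one at m + 1 eliminates g l; the remaining
   factor z^-k - z^-l is nonzero because k and l are distinct and less than n. *)
have : g k * z^-1 ^+ (k * m) * (z^-1 ^+ k - z^-1 ^+ l) = 0.
  have := congr1 (fun x => 0 - x * z^-1 ^+ l) d0.
  by rewrite mul0r subr0 -{1}d1 => <-; ring.
move/eqP; rewrite !mulf_eq0 (negbTE (zV0 _)) orbF subr_eq0 => /orP[/eqP//|].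
rewrite !exprVn (inj_eq invr_inj) (eq_prim_root_expr prim_z) !modn_small //.
by move=> /eqP/val_inj kl'; rewrite kl' eqxx in kl.
Qed.

End RootsOfUnity.

(** * The frequencies of a Ramanujan sum *)

(** The product form avoids a division; for q dividing N, these are the j for which w^j has order
    exactly q. *)
Definition freqs (N q : nat) : {set 'I_N} := [set j : 'I_N | gcdn j N * q == N]%N.

Lemma sum_freqs (V : nmodType) (N q : nat) (F : nat -> V) :
    (0 < N)%N -> (q %| N)%N ->
  \sum_(j in freqs N q) F j = \sum_(k < q | coprime k q) F (k * (N %/ q))%N.
Proof.
move=> N_gt0 qN; have q_gt0 := dvdn_gt0 N_gt0 qN.
move: qN N_gt0 => /dvdnP[r ->]; rewrite muln_gt0 mulnK // => /andP[r_gt0 _].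
have kr (k : 'I_q) : (k * r < r * q)%N by rewrite mulnC ltn_pmul2l.
pose h k := Ordinal (kr k).
have h_inj : injective h.
  by move=> k l /(congr1 val) /eqP /=; rewrite eqn_pmul2r // => /eqP/val_inj.
suff -> : freqs (r * q) q = h @: [set k : 'I_q | coprime k q].
  rewrite big_imset /=; last by move=> ? ? _ _; apply: h_inj.
  by apply: eq_bigl => k; rewrite inE.
apply/setP => j; rewrite inE; apply/idP/imsetP => [gj|[k]].
  have gr : gcdn j (r * q) = r.
    by apply/eqP; rewrite -(eqn_pmul2r q_gt0) (eqP gj).
  have rj : (r %| j)%N by rewrite -{1}gr dvdn_gcdl.
  have jq : (j %/ r < q)%N by rewrite ltn_divLR // [(q * r)%N]mulnC.
  exists (Ordinal jq); last by apply: val_inj; rewrite /= divnK.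
  by rewrite inE /coprime -(eqn_pmul2r r_gt0) mul1n muln_gcdl /= divnK // [(q * r)%N]mulnC gr.
by rewrite inE => /eqP kq ->; rewrite /= [(r * q)%N]mulnC -muln_gcdl kq mul1n mulnC.
Qed.

Lemma card_freqs (N q : nat) :
  (0 < N)%N -> (q %| N)%N -> #|freqs N q| = totient q.
Proof.
move=> N_gt0 qN; rewrite -sum1_card (sum_freqs (fun=> 1%N)) //.
rewrite totient_count_coprime big_mkord big_mkcond.
by apply: eq_bigr => k _; rewrite coprime_sym; case: coprime.
Qed.

(** In the product formula, each prime of q occurs in N with at least the same exponent, and the
    remaining factors of N are at least 1. This makes one hypothesis on totient N serve all
    divisors. *)
Lemma totient_leq_dvd (q N : nat) :
  (0 < N)%N -> (q %| N)%N -> (totient q <= totient N)%N.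
Proof.
move=> N_gt0 qN; have q_gt0 := dvdn_gt0 N_gt0 qN.
rewrite !totientE //.
have sub : {subset primes q <= primes N}.
  move=> p; rewrite !mem_primes q_gt0 N_gt0 /= => /andP[-> /=].
  by move/dvdn_trans; apply.
rewrite [leqRHS](bigID (mem (primes q))) /= -[leqLHS]muln1.
have pr_gt0 p : p \in primes N -> (0 < p.-1 * p ^ (logn p N).-1)%N.
  rewrite mem_primes => /and3P[pp _ _].
  by rewrite muln_gt0 expn_gt0 (prime_gt0 pp) ltn_predRL prime_gt1.
apply: leq_mul; last first.
  by rewrite big_seq_cond prodn_cond_gt0 // => p /andP[/pr_gt0].
rewrite -[X in (_ <= X)%N]big_filter.
rewrite (@perm_big _ _ _ _ [seq x <- primes N | x \in primes q] (primes q)) /=.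
  rewrite big_seq [leqRHS]big_seq; apply: leq_prod => p.
  rewrite mem_primes => /and3P[pp _ _]; rewrite leq_mul2l leq_exp2l ?prime_gt1 //.
  by rewrite -!subn1 leq_sub2r ?orbT // dvdn_leq_log.
apply: uniq_perm; rewrite ?filter_uniq ?primes_uniq // => p.
by rewrite mem_filter andb_idr //; apply: sub.
Qed.

Lemma dotE (C : numClosedFieldType) (n : nat) (x y : 'rV[C]_n) :
  dotmx x y = \sum_i x 0 i * (y 0 i)^*.
Proof. by rewrite dotmxE mxE; apply: eq_bigr => i _; rewrite !mxE. Qed.

(** * Fourier analysis on Z_N and Ramanujan sums *)

Section Fourier.
Variables (R : realType) (N : nat).
Hypothesis N_gt0 : (0 < N)%N.
Local Notation C := R[i].
Local Notation w := (unity_root R N).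
Let w_prim : N.-primitive_root w := unity_root_prim R N_gt0.

Definition expvec (j : nat) : 'rV[C]_N := \row_n w ^+ (j * n).

Lemma dotmx_suml (I : finType) (P : pred I) (c : I -> C) (f : I -> 'rV[C]_N) y :
  dotmx (\sum_(i | P i) c i *: f i) y = \sum_(i | P i) c i * dotmx (f i) y.
Proof. by rewrite linear_sumlz; apply: eq_bigr => i _; rewrite linearZl_LR. Qed.

Lemma dotmx_sumr (I : finType) (P : pred I) (c : I -> C) (f : I -> 'rV[C]_N) x :
  dotmx x (\sum_(i | P i) c i *: f i) = \sum_(i | P i) (c i)^* * dotmx x (f i).
Proof. by rewrite linear_sumr; apply: eq_bigr => i _; rewrite linearZr. Qed.

Lemma dot_expvec (i j : 'I_N) :
  dotmx (expvec i) (expvec j) = (N * (i == j))%:R.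
Proof.
rewrite dotE -[i == j]/(i == j :> nat) -{2}(modn_small (ltn_ord i)).
rewrite -{2}(modn_small (ltn_ord j)) -(sum_prim_root w_prim).
apply: eq_bigr => n _; rewrite !mxE rmorphXn /= (prim_root_conj w_prim).
by rewrite ![(n * _)%N]mulnC.
Qed.

(** Parseval with time and frequency exchanged: the conjugate of <x, e_j> is a trigonometric sum in
    j with coefficients the conjugates of x(n). *)
Lemma sum_sqr_dot_expvec (x : 'rV[C]_N) :
  \sum_(j < N) `|dotmx x (expvec j)| ^+ 2 = N%:R * sqnorm x.
Proof.
have inj : {in [set: 'I_N] &, forall i j, val i = val j %[mod N] -> i = j}.
  by move=> i j _ _; rewrite !modn_small ?ltn_ord // => /val_inj.
transitivity (N%:R * \sum_(n in [set: 'I_N]) `|(x 0 n)^*| ^+ 2).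
  rewrite -(sum_prim_root_sqnorm w_prim _ inj); apply: eq_bigr => j _.
  rewrite -norm_conjC dotE rmorph_sum /=; congr (`|_| ^+ 2).
  by apply: eq_big => n; rewrite ?inE // rmorphM /= conjCK mxE.
congr (_ * _); rewrite /sqnorm dotE; apply: eq_big => n; rewrite ?inE // => _.
by rewrite norm_conjC normCK.
Qed.

Lemma ramanujanE (q n : nat) : (q %| N)%N ->
  ramanujan R q n = \sum_(j in freqs N q) w ^+ (j * n).
Proof.
move=> qN; have q_gt0 := dvdn_gt0 N_gt0 qN.
rewrite (sum_freqs (fun j => w ^+ (j * n))) //.
set F : nat -> C := fun k => w ^+ (k * (N %/ q) * n).
have -> : ramanujan R q n = \sum_(1 <= k < q.+1 | coprime k q) F k.
  apply: eq_bigr => k _; rewrite /F -expiMn; congr expi.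
  have NE : N%:R = (N %/ q)%:R * q%:R :> R by rewrite -natrM divnK.
  rewrite -[_ *+ (k * _ * n)]mulr_natr NE !natrM.
  by field; rewrite !pnatr_eq0 -!lt0n q_gt0 divn_gt0 // dvdn_leq.
rewrite -(big_mkord (fun k => coprime k q) F) big_mkcond [RHS]big_mkcond /=.
pose G k := if coprime k q then F k else 0.
(* The Ramanujan sum runs over 1 <= k <= q, the other sum over 0 <= k < q; the end terms agree, and
   are present only for q = 1. *)
have GE : G q = G 0%N.
  rewrite /G /coprime gcdnn gcd0n; case: eqP => // _.
  by rewrite /F [(q * _)%N]mulnC divnK // mul0n exprM (prim_expr_order w_prim) expr1n.
have : \sum_(0 <= k < q.+1) G k = G 0%N + \sum_(1 <= k < q.+1) G k.
  by rewrite big_ltn.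
by rewrite big_nat_recr //= GE addrC => /addrI.
Qed.

(** The additive form avoids truncated subtraction. *)
Lemma cshift_indexE (m : nat) (n : 'I_N) :
  (cshift_index m%:Z n + m = n %[mod N])%N.
Proof.
have N0 : N%:Z != 0 by lia.
have bnd : (`|((n%:Z - m%:Z) %% N%:Z)%Z| < N)%N.
  by have := modz_ge0 (n%:Z - m%:Z) N0; have := ltz_mod (n%:Z - m%:Z) N0; lia.
rewrite /cshift_index val_insubd bnd.
apply: (congr1 absz (x := Posz _) (y := Posz _)); rewrite -!modz_nat PoszD.
by rewrite gez0_abs ?modz_ge0 // modzDml subrK.
Qed.

Lemma shifted_ramanujanE (p q k : nat) : (q %| N)%N ->
  shifted_ramanujan R N p q k =
  \sum_(j in freqs N q) w^-1 ^+ (p * k * j) *: expvec j.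
Proof.
move=> qN; apply/rowP => n; rewrite !mxE ramanujanE // summxE.
apply: eq_bigr => j _; rewrite !mxE.
have wn0 m : w ^+ m != 0 by rewrite expf_neq0 // (prim_root_neq0 w_prim).
apply: (mulIf (wn0 (p * k * j)%N)).
rewrite exprVn mulrAC mulVf // mul1r -exprD [(p * k * j)%N]mulnC -mulnDr.
apply/eqP; rewrite (eq_prim_root_expr w_prim) -modnMmr cshift_indexE.
by rewrite modnMmr.
Qed.

Lemma dot_shifted_ramanujan (p q k : nat) (x : 'rV[C]_N) : (q %| N)%N ->
  dotmx x (shifted_ramanujan R N p q k) =
  \sum_(j in freqs N q) dotmx x (expvec j) * (w ^+ p) ^+ (k * j).
Proof.
move=> qN; rewrite shifted_ramanujanE // dotmx_sumr; apply: eq_bigr => j _.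
rewrite rmorphXn /= rmorphV ?unitfE ?(prim_root_neq0 w_prim) //=.
by rewrite (prim_root_conj w_prim) invrK mulrC -exprM mulnA.
Qed.

Lemma dot_shifted_ramanujan_expvec (p q k : nat) (j : 'I_N) : (q %| N)%N ->
  dotmx (shifted_ramanujan R N p q k) (expvec j) =
  if j \in freqs N q then N%:R * w^-1 ^+ (p * k * j) else 0.
Proof.
move=> qN; rewrite shifted_ramanujanE // dotmx_suml.
case: ifP => [jJ|/negP jJ]; last first.
  apply: big1 => i iJ; rewrite dot_expvec; case: eqP => [ij|_].
    by rewrite -ij in jJ.
  by rewrite muln0 mulr0.
rewrite (bigD1 j) //= big1 ?addr0 => [|i /andP[_ ij]].
  by rewrite dot_expvec eqxx muln1 mulrC.
by rewrite dot_expvec (negbTE ij) muln0 mulr0.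
Qed.

End Fourier.

(** * Frequencies modulo d *)

Lemma freqs_gcd (N q : nat) (i : 'I_N) :
  (q %| N)%N -> (i \in freqs N q) = (gcdn i N == N %/ q)%N.
Proof.
have N_gt0 : (0 < N)%N by apply: leq_trans (ltn_ord i).
move=> qN; have q_gt0 := dvdn_gt0 N_gt0 qN.
by rewrite inE -[X in (_ == X) = _](divnK qN) eqn_pmul2r.
Qed.

(** For p = 1 the frequencies are already below d. For p = 2, N is even, so equal gcds with N force
    equal parity; two frequencies below 2d that are congruent modulo d differ by 0 or by d, and d is
    odd. *)
Lemma freqs_mod_inj (N p d q : nat) :
    N = (p * d)%N -> (q %| N)%N -> p = 1%N \/ p = 2 /\ odd d ->
  {in freqs N q &, forall i j, val i = val j %[mod d] -> i = j}.
Proof.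
move=> NE qN p12 i j; rewrite !freqs_gcd // => /eqP <- /eqP gij ij.
apply: val_inj => /=; move: ij => /= ij.
have iN : (i < p * d)%N by rewrite -NE.
have jN : (j < p * d)%N by rewrite -NE.
case: p12 => [p1|[p2 d_odd]].
  by move: iN jN; rewrite p1 mul1n => id jd; rewrite !modn_small // in ij.
have odd_ij : odd i = odd j.
  have N2 : (2 %| N)%N by rewrite NE p2 dvdn_mulr.
  have : (2 %| gcdn i N)%N = (2 %| gcdn j N)%N by rewrite gij.
  by rewrite !dvdn_gcd N2 !andbT !dvdn2 => /negb_inj.
rewrite p2 in iN jN.
have d_gt0 : (0 < d)%N by lia.
move: odd_ij; rewrite (divn_eq i d) (divn_eq j d) ij.
have : (i %/ d < 2)%N by rewrite ltn_divLR.
have : (j %/ d < 2)%N by rewrite ltn_divLR.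
rewrite !oddD !oddM d_odd !andbT.
by case: (i %/ d)%N => [|[|]] //; case: (j %/ d)%N => [|[|]] //=; case: odd.
Qed.

(** If the residue 0 is attained, then d divides the common gcd N / q, so every frequency is a
    multiple of d and the residue 1 is missed. *)
Lemma freqs_gap1 (N d q : nat) : (1 < d)%N -> (d %| N)%N -> (q %| N)%N ->
  exists m, {in freqs N q, forall i, val i != m %[mod d]}.
Proof.
move=> d_gt1 dN qN.
have [/forall_inP i0|] := boolP [forall i in freqs N q, val i != 0 %[mod d]].
  by exists 0%N.
rewrite negb_forall_in => /exists_inP[j]; rewrite negbK mod0n freqs_gcd //.
move=> gj dj; exists 1%N => i; rewrite freqs_gcd //= => /eqP gi; apply/negP => i1.
have : (d %| gcdn i N)%N by rewrite gi -(eqP gj) dvdn_gcd dN andbT.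
move/dvdn_trans/(_ (dvdn_gcdl _ _)); rewrite /dvdn (eqP i1) modn_small //.
Qed.

(** By counting: the residues of J and those of J - 1 number at most 2 totient N < d together, so
    some m avoids both. *)
Lemma freqs_gap2 (N d q : nat) :
    (0 < d)%N -> (0 < N)%N -> (q %| N)%N -> (2 * totient N <= d - 1)%N ->
  exists m, {in freqs N q, forall i, val i != m %[mod d]} /\
            {in freqs N q, forall i, val i != m.+1 %[mod d]}.
Proof.
move=> d_gt0 N_gt0 qN small.
pose f s (i : 'I_N) : 'I_d := Ordinal (ltn_pmod (i + s) d_gt0).
have card_f s : (#|f s @: freqs N q| <= totient N)%N.
  by rewrite (leq_trans (leq_imset_card _ _)) // card_freqs ?totient_leq_dvd.
(* Adding d - 1 stands for subtracting 1 modulo d. *)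
pose B := f 0%N @: freqs N q :|: f d.-1 @: freqs N q.
have : (0 < #|~: B|)%N.
  have cB : (#|B| <= 2 * totient N)%N.
    rewrite mul2n -addnn; apply: leq_trans (leq_add (card_f _) (card_f _)).
    exact: leq_card_setU.
  by have := cardsC B; rewrite card_ord; lia.
case/card_gt0P => m; rewrite !inE negb_or => /andP[m0 m1].
exists m; split=> i Ji; apply/negP => /eqP im.
  move/imsetP: m0; apply; exists i => //; apply: val_inj.
  by rewrite /= addn0 im modn_small.
move/imsetP: m1; apply; exists i => //; apply: val_inj => /=.
rewrite -modnDml im modnDml addSnnS prednK // modnDr modn_small //.
Qed.

(** * Spans, projections and a lower bound for injective matrices *)

Section FamilySpan.
Variables (R : realType) (N : nat) (I : finType) (D : {set I}).
Variable f : I -> 'rV[R[i]]_N.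

Lemma mem_family_span k : k \in D -> (f k <= family_span D f)%MS.
Proof. by move=> Dk; apply: (sumsmx_sup k); rewrite ?genmxE. Qed.

Lemma family_span_sub m (U : 'M_(m, N)) :
  (forall k, k \in D -> (f k <= U)%MS) -> (family_span D f <= U)%MS.
Proof. by move=> fU; apply/sumsmx_subP => k Dk; rewrite genmxE fU. Qed.

Lemma family_span_orth (x v : 'rV[R[i]]_N) :
    (forall k, k \in D -> dotmx (f k) v = 0) -> (x <= family_span D f)%MS ->
  dotmx x v = 0.
Proof.
move=> fv xf; apply/eqP; rewrite -orthomxE; apply: submx_trans xf _.
by apply: family_span_sub => k /fv/eqP; rewrite -orthomxE.
Qed.

End FamilySpan.

Lemma dotmx_sub_proj_ortho (R : realType) (N : nat) (U : 'M[R[i]]_N)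
    (x v : 'rV[R[i]]_N) :
  (v <= U)%MS -> dotmx (x - x *m proj_ortho U) v = 0.
Proof.
case/submxP=> D ->; have /orthomx1P xU := proj_ortho_compl_sub U x.
by rewrite dotmxE trmx_mul map_mxM mulmxA xU mul0mx mxE.
Qed.

(** With M X = 1, each coordinate of v is the inner product of v M with a conjugated column of X.
    Cauchy-Schwarz bounds the sum of their squares by T times the squared norm of v M, with T the
    squared Frobenius norm of X; 1 + T is used to have a positive constant. *)
Lemma row_free_lower_bound (C : numClosedFieldType) (m n : nat) (M : 'M[C]_(m, n)) :
    row_free M ->
  exists2 c : C, 0 < c & forall v : 'rV_m,
    c * \sum_i `|v 0 i| ^+ 2 <= \sum_k `|(v *m M) 0 k| ^+ 2.
Proof.
case/row_freeP=> X MX; pose T := \sum_i dotmx (row i (X ^t*)) (row i (X ^t*)).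
have T1 : 0 < 1 + T by rewrite ltr_wpDr // sumr_ge0 // => i _; apply: dnorm_ge0.
exists (1 + T)^-1; rewrite ?invr_gt0 // => v.
rewrite mulrC ler_pdivrMr //.
pose S := \sum_k `|(v *m M) 0 k| ^+ 2; rewrite -/S; have SE : S = dotmx (v *m M) (v *m M).
  by rewrite /S dotE; apply: eq_bigr => k _; rewrite normCK.
have vE i : v 0 i = dotmx (v *m M) (row i (X ^t*)).
  rewrite -[v in LHS]mulmx1 -MX mulmxA dotE mxE; apply: eq_bigr => k _.
  by rewrite !mxE conjCK.
apply: (@le_trans _ _ (S * T)); last first.
  by rewrite ler_wpM2l ?lerDr // /S sumr_ge0 // => k _; rewrite exprn_ge0.
rewrite mulr_sumr; apply: ler_sum => i _; rewrite SE vE.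
exact: CauchySchwarz.
Qed.

(** * The erased family for one divisor q *)

Section Erasure.
Variables (R : realType) (N p d q : nat).
Hypotheses (N_gt0 : (0 < N)%N) (NE : N = (p * d)%N) (qN : (q %| N)%N).
Local Notation C := R[i].
Local Notation w := (unity_root R N).
Local Notation J := (freqs N q).
Local Notation f := (shifted_ramanujan R N p q).
Local Notation e := (expvec R N).
Let w_prim : N.-primitive_root w := unity_root_prim R N_gt0.

Let d_gt0 : (0 < d)%N.
Proof. by move: N_gt0; rewrite NE muln_gt0 => /andP[]. Qed.

Lemma unity_root_exp_prim : d.-primitive_root (w ^+ p).
Proof.
have dN : (d %| N)%N by rewrite NE dvdn_mull.
by have := dvdn_prim_root w_prim dN; rewrite {2}NE mulnK.
Qed.

(* f_k is a combination of the e_j (j in J) with coefficients the k-th powers of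
   #|J| numbers; reducing X^k modulo the polynomial with these roots expresses
   f_k by f_0, ..., f_(#|J| - 1). *)
Lemma shifted_ramanujan_in_space (k : nat) : (f k <= ramanujan_space R N p q)%MS.
Proof.
pose u (j : 'I_N) := w^-1 ^+ (p * j).
pose P := \prod_(j <- enum J) ('X - (u j)%:P).
pose r := 'X^k %% P.
have sP : size P = (totient q).+1.
  by rewrite size_prod_XsubC -cardE card_freqs.
have sr : (size r <= totient q)%N.
  by rewrite -ltnS -sP ltn_modp -size_poly_eq0 sP.
have ru j : j \in J -> u j ^+ k = \sum_(l < totient q) r`_l * u j ^+ l.
  move=> jJ; rewrite -(horner_coef_wide _ sr).
  have Pu : P.[u j] = 0.
    by rewrite /P big_enum /= horner_prod (bigD1 j) //= hornerXsubC subrr mul0r.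
  by have := congr1 (horner^~ (u j)) (divp_eq 'X^k P);
     rewrite hornerXn hornerD hornerM Pu mulr0 add0r.
have fE l : f l = \sum_(j in J) u j ^+ l *: e j.
  rewrite shifted_ramanujanE //; apply: eq_bigr => j _; congr (_ *: _).
  by rewrite -exprM mulnAC.
have -> : f k = \sum_(l < totient q) r`_l *: f l.
  rewrite fE; under eq_bigr => j jJ do rewrite (ru j jJ) scaler_suml.
  rewrite exchange_big; apply: eq_bigr => l _.
  by rewrite fE scaler_sumr; apply: eq_bigr => j _; rewrite scalerA.
apply: summx_sub => l _; apply: scalemx_sub.
by apply: (@mem_family_span _ _ _ _ (fun l : 'I_(totient q) => f l)); rewrite inE.
Qed.

Lemma dot_ramanujan_space (x : 'rV[C]_N) (j : 'I_N) :
  (x <= ramanujan_space R N p q)%MS -> j \notin J -> dotmx x (e j) = 0.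
Proof.
move=> xS jJ; apply: family_span_orth xS => k _.
by rewrite dot_shifted_ramanujan_expvec // (negbTE jJ).
Qed.

Lemma sqnorm_freqs (x : 'rV[C]_N) :
    (forall j, j \notin J -> dotmx x (e j) = 0) ->
  N%:R * sqnorm x = \sum_(j in J) `|dotmx x (e j)| ^+ 2.
Proof.
move=> xJ; rewrite -sum_sqr_dot_expvec // (bigID (mem J)) /= [X in _ + X]big1 ?addr0 //.
by move=> j /xJ ->; rewrite normr0 expr0n.
Qed.

Hypothesis J_inj : {in J &, forall i j, val i = val j %[mod d] -> i = j}.

Lemma sum_sqr_dot_shifted_ramanujan (x : 'rV[C]_N) :
  \sum_(k < d) `|dotmx x (f k)| ^+ 2 =
  d%:R * \sum_(j in J) `|dotmx x (e j)| ^+ 2.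
Proof.
rewrite -(sum_prim_root_sqnorm unity_root_exp_prim _ J_inj).
by apply: eq_bigr => k _; rewrite dot_shifted_ramanujan.
Qed.

(** Nonnegative terms are added twice, first for k in L and then for j outside J; the constant is d
    N = p d^2. *)
Lemma sum_sqr_dot_shifted_ramanujan_le (L : {set 'I_d}) (x : 'rV[C]_N) :
  \sum_(k in ~: L) `|dotmx x (f k)| ^+ 2 <= (p * d ^ 2)%:R * sqnorm x.
Proof.
apply: (@le_trans _ _ (\sum_(k < d) `|dotmx x (f k)| ^+ 2)).
  rewrite [leRHS](bigID (mem (~: L))) /= lerDl sumr_ge0 // => k _.
  exact: exprn_ge0.
rewrite sum_sqr_dot_shifted_ramanujan expnS expn1 mulnA -NE mulnC natrM -mulrA.
rewrite -sum_sqr_dot_expvec // ler_wpM2l ?ler0n //.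
rewrite [leRHS](bigID (mem J)) /= lerDl sumr_ge0 // => j _.
exact: exprn_ge0.
Qed.

(** Compare with the upper bound at c_q = f_0, which is nonzero because its inner product with e_j
    is N for j in J. This keeps the final lower fusion bound at most 1. *)
Lemma lower_frame_bound_le (L : {set 'I_d}) (A : R) :
    lower_frame_bound (ramanujan_space R N p q) (~: L) f A ->
  A <= (p * d ^ 2)%:R.
Proof.
case=> _ /(_ (f 0%N) (shifted_ramanujan_in_space 0)) AP.
have [j jJ] : exists j, j \in J.
  by apply/card_gt0P; rewrite card_freqs // totient_gt0 (dvdn_gt0 N_gt0).
have f0 : 0 < sqnorm (f 0%N).
  rewrite /sqnorm dnorm_gt0; apply/eqP => f0.
  have := dot_shifted_ramanujan_expvec R N_gt0 p 0 j qN; rewrite jJ f0.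
  rewrite linear0l muln0 mul0n expr0 mulr1 => /esym/eqP.
  by rewrite pnatr_eq0 -leqn0 leqNgt N_gt0.
have := le_trans AP (sum_sqr_dot_shifted_ramanujan_le L (f 0%N)).
by rewrite ler_pM2r // -(rmorph_nat (real_complex R)) lecR.
Qed.

Variable L : {set 'I_d}.
Hypothesis L_gap : uniqueness_gap J val L.

(** Such an x gives a trigonometric sum k -> <x, f_k> supported on L, so the gap condition kills its
    coefficients. *)
Lemma dot_expvec_eq0 (x : 'rV[C]_N) :
    (forall k, k \notin L -> dotmx x (f k) = 0) ->
  {in J, forall j : 'I_N, dotmx x (e j) = 0}.
Proof.
move=> xf; apply: (trig_sum_eq0 unity_root_exp_prim J_inj L_gap) => k kL.
by rewrite -dot_shifted_ramanujan // xf.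
Qed.

Lemma lower_frame_bound_ex :
  exists A : R, lower_frame_bound (ramanujan_space R N p q) (~: L) f A.
Proof.
(* The matrix [M1 M2] sends x to its coefficients <x, e_j>, j outside J, and
   <x, f_k>, k outside L; it is injective, and the first block vanishes on
   the Ramanujan space. *)
pose M1 : 'M[C]_N := \matrix_(n, j) if j \in J then 0 else (e j 0 n)^*.
pose M2 : 'M[C]_(N, d) := \matrix_(n, k) if k \in L then 0 else (f k 0 n)^*.
have xM1 (x : 'rV_N) j : (x *m M1) 0 j = if j \in J then 0 else dotmx x (e j).
  rewrite mxE; case: ifP => jJ; last rewrite dotE.
    by apply: big1 => n _; rewrite mxE jJ mulr0.
  by apply: eq_bigr => n _; rewrite mxE jJ.
have xM2 (x : 'rV_N) k : (x *m M2) 0 k = if k \in L then 0 else dotmx x (f k).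
  rewrite mxE; case: ifP => kL; last rewrite dotE.
    by apply: big1 => n _; rewrite mxE kL mulr0.
  by apply: eq_bigr => n _; rewrite mxE kL.
have N0 : N%:R != 0 :> C by rewrite pnatr_eq0 -lt0n.
(* A kernel vector has <x, e_j> = 0 outside J by [M1] and, through [M2] and [dot_expvec_eq0], also
   inside J; Parseval then gives x = 0. *)
have M_free : row_free (row_mx M1 M2).
  apply: inj_row_free => x; rewrite mul_mx_row -[0]row_mx0 => /eq_row_mx[x1 x2].
  have xJ j : j \notin J -> dotmx x (e j) = 0.
    by have := xM1 x j; rewrite x1 mxE; case: ifP.
  have := sqnorm_freqs xJ; rewrite big1 => [/eqP|j jJ].
    by rewrite mulf_eq0 (negbTE N0) dnorm_eq0 => /eqP.
  rewrite (dot_expvec_eq0 (x := x)) ?normr0 ?expr0n // => k kL.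
  by have := xM2 x k; rewrite x2 mxE (negbTE kL).
have [c c_gt0 cP] := row_free_lower_bound M_free.
have cE : (complex.Re c)%:C%C = c by rewrite RRe_real // gtr0_real.
exists (complex.Re c); split=> [|x xS]; first by rewrite -(ltcR 0) cE.
rewrite cE; have -> : sqnorm x = \sum_n `|x 0 n| ^+ 2.
  by rewrite /sqnorm dotE; apply: eq_bigr => n _; rewrite normCK.
have := cP x; rewrite mul_mx_row big_split_ord /=.
rewrite [X in _ <= X + _]big1 ?add0r => [|j _]; last first.
  rewrite row_mxEl xM1; case: ifP => [_|/negbT jJ]; first by rewrite normr0 expr0n.
  by rewrite dot_ramanujan_space // normr0 expr0n.
suff -> : \sum_(k in ~: L) `|dotmx x (f k)| ^+ 2 =
    \sum_(k < d) `|row_mx (x *m M1) (x *m M2) 0 (rshift N k)| ^+ 2.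
  by [].
rewrite big_mkcond; apply: eq_bigr => k _; rewrite row_mxEr xM2 inE.
by case: (k \in L); rewrite /= ?normr0 ?expr0n.
Qed.

Lemma erased_frame : is_frame (ramanujan_space R N p q) (~: L) (fun k : 'I_d => f k).
Proof.
split=> [k _|]; first exact: shifted_ramanujan_in_space.
have [A AP] := lower_frame_bound_ex.
exists A, (p * d ^ 2)%:R; split=> //; split=> [|x _].
  by rewrite ltr0n expnS expn1 mulnA -NE muln_gt0 N_gt0.
by rewrite (rmorph_nat (real_complex R)); apply: sum_sqr_dot_shifted_ramanujan_le.
Qed.

(** The projection y has no coefficient outside J, and x - y is orthogonal to every remaining f_k,
    so it has none inside J. Hence y carries exactly the J-coefficients of x, whatever L was. *)
Lemma sqnorm_proj_erased (x : 'rV[C]_N) :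
  N%:R * sqnorm (x *m proj_ortho (erased_ramanujan_space R N p q L)) =
  \sum_(j in J) `|dotmx x (e j)| ^+ 2.
Proof.
set W := erased_ramanujan_space R N p q L; set y := x *m _.
have yW : (y <= W)%MS := proj_ortho_sub _ _.
rewrite (sqnorm_freqs (x := y)) => [|j jJ]; last first.
  apply: family_span_orth yW => k _.
  by rewrite dot_shifted_ramanujan_expvec // (negbTE jJ).
have xyJ : {in J, forall j : 'I_N, dotmx (x - y) (e j) = 0}.
  apply: dot_expvec_eq0 => k kL; apply: dotmx_sub_proj_ortho.
  by apply: (@mem_family_span _ _ _ _ (fun k : 'I_d => f k)); rewrite inE.
apply: eq_bigr => j /xyJ; rewrite linearBl => /eqP.
by rewrite subr_eq0 => /eqP ->.
Qed.

End Erasure.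

(** * All divisors together *)

(** Each j is a frequency for exactly one divisor, namely N / gcd(j, N). *)
Lemma sum_freqs_divisors (V : nmodType) (N K : nat) (q : 'I_K -> nat) (F : 'I_N -> V) :
    (0 < N)%N -> perm_eq (codom q) (divisors N) ->
  \sum_(i < K) \sum_(j in freqs N (q i)) F j = \sum_j F j.
Proof.
move=> N_gt0 qN.
rewrite -(big_map q xpredT (fun c => \sum_(j in freqs N c) F j)) -/(index_enum _).
rewrite -[index_enum _]enumT -/(codom q) (perm_big _ qN) /=.
rewrite (exchange_big_dep xpredT) //=; apply: eq_bigr => j _.
have gN : (gcdn j N %| N)%N by rewrite dvdn_gcdr.
have g_gt0 : (0 < gcdn j N)%N by rewrite (dvdn_gt0 N_gt0).
rewrite (big_rem (N %/ gcdn j N)%N) /= -?dvdn_divisors ?dvdn_div //.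
rewrite inE mulnC divnK // eqxx big1_seq ?addr0 // => c.
rewrite inE (mem_rem_uniq _ (divisors_uniq N)) !inE => /andP[/eqP gc] /andP[/negP[]].
by rewrite -{1}gc mulKn.
Qed.

Theorem theorem2p32 (R : realType) (N p d : nat)
    (p_gt0 : (0 < p)%N) (d_gt0 : (0 < d)%N) (N_pd : N = (p * d)%N)
    (K : nat) (q : 'I_K -> nat)
    (q_divisors : perm_eq (codom q) (divisors N))
    (L : 'I_K -> {set 'I_d}) :
  [\/ (* (a)(i) *)
      [/\ p = 1%N, (2 <= N)%N & forall i, (#|L i| <= 1)%N],
      (* (a)(ii); the last condition is automatic unless d = 1, i.e. N = 2, where
         it excludes the erasure of the only vector *)
      [/\ p = 2%N, (2 <= N)%N, odd d, (forall i, (#|L i| <= 1)%N)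
        & forall i, L i != [set: 'I_d] ],
      (* (b)(i) *)
      [/\ p = 1%N, (2 * totient N <= N - 1)%N & forall i, (#|L i| <= 2)%N]
    | (* (b)(ii) *)
      [/\ p = 2%N, odd d, (2 * totient N <= d - 1)%N
        & forall i, (#|L i| <= 2)%N] ] ->
  let W i := erased_ramanujan_space R N p (q i) (L i) in
  [/\ is_fusion_frame W,
      forall i, is_frame (ramanujan_space R N p (q i)) (~: L i)
                  (fun k : 'I_d => shifted_ramanujan R N p (q i) k)
    & forall (A : 'I_K -> R) (i0 : 'I_K),
        (forall i, lower_frame_bound (ramanujan_space R N p (q i)) (~: L i)
                     (fun k : 'I_d => shifted_ramanujan R N p (q i) k) (A i)) ->
        fusion_frame_bounds W
          (\big[Num.min/A i0]_(i < K) A i / (p * d ^ 2)%:R) 1].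
Proof.
move=> cases; have N_gt0 : (0 < N)%N by rewrite N_pd muln_gt0 p_gt0.
have qN i : (q i %| N)%N.
  by rewrite dvdn_divisors // -(perm_mem q_divisors) codom_f.
have dN : (d %| N)%N by rewrite N_pd dvdn_mull.
have p12 : p = 1%N \/ p = 2 /\ odd d by case: cases => [[]|[]|[]|[]]; auto.
have J_inj i := freqs_mod_inj N_pd (qN i) p12.
have L_gap i : uniqueness_gap (freqs N (q i)) val (L i).
  have gap1 : (1 < d)%N -> (#|L i| <= 1)%N -> uniqueness_gap (freqs N (q i)) val (L i).
    by move=> d_gt1; have [m] := freqs_gap1 d_gt1 dN (qN i); right; exists m; auto.
  have gap2 : (2 * totient N <= d - 1)%N -> (#|L i| <= 2)%N ->
      uniqueness_gap (freqs N (q i)) val (L i).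
    move=> d_small; have [m []] := freqs_gap2 d_gt0 N_gt0 (qN i) d_small.
    by right; exists m; auto.
  case: cases => [[p1 N2 L1]|[p2 _ d_odd L1 LT]|[p1 d2 L2]|[_ _ d2 L2]].
  - by apply: gap1 => //; rewrite N_pd p1 mul1n in N2.
  - have [d1|d_le1] := ltnP 1 d; first exact: gap1.
    (* For d = 1 there is only one residue and no gap; being a proper subset, [L i] is empty. *)
    left; apply/eqP; rewrite -cards_eq0 -leqn0 -ltnS.
    have /proper_card : L i \proper [set: 'I_d] by rewrite properT LT.
    by rewrite cardsT card_ord => /leq_trans; apply.
  - by apply: gap2 => //; rewrite {2}N_pd p1 mul1n in d2.
  - exact: gap2.
move=> W.
have frameW i := erased_frame R N_gt0 N_pd (qN i) (J_inj i) (L_gap i).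
(* Times N, the projections collect |<x, e_j>|^2 over sets of frequencies that partition Z_N, so
   Parseval gives equality. Any lower constant in (0, 1] is then valid. *)
have sumW x : \sum_(i < K) sqnorm (x *m proj_ortho (W i)) = sqnorm x.
  have N0 : N%:R != 0 :> R[i] by rewrite pnatr_eq0 -lt0n.
  apply: (mulfI N0); rewrite mulr_sumr -sum_sqr_dot_expvec //.
  rewrite -(sum_freqs_divisors _ N_gt0 q_divisors); apply: eq_bigr => i _.
  exact: sqnorm_proj_erased.
have boundsW A i0 :
    (forall i, lower_frame_bound (ramanujan_space R N p (q i)) (~: L i)
       (fun k : 'I_d => shifted_ramanujan R N p (q i) k) (A i)) ->
    fusion_frame_bounds W (\big[Num.min/A i0]_(i < K) A i / (p * d ^ 2)%:R) 1.
  move=> AP; set m := \big[_/_]_(i < K) _.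
  have m_gt0 : 0 < m.
    rewrite /m; elim/big_ind: _ => [|a b a0 b0|i _]; rewrite ?lt_min ?a0 //.
      by have [] := AP i0.
    by have [] := AP i.
  have pd2 : (0 : R) < (p * d ^ 2)%:R by rewrite ltr0n muln_gt0 p_gt0 expn_gt0 d_gt0.
  (* The default value [A i0] also bounds the minimum from above, and it is at most p d^2. *)
  have m1 : m / (p * d ^ 2)%:R <= 1.
    rewrite ler_pdivrMr // mul1r.
    apply: le_trans (lower_frame_bound_le N_gt0 N_pd (qN i0) (J_inj i0) (AP i0)).
    exact: bigmin_le_id.
  split; first by rewrite divr_gt0.
  move=> x; rewrite sumW rmorph1 mul1r lexx andbT ler_piMl ?dnorm_ge0 //.
  by rewrite -(rmorph1 (real_complex R)) lecR.
split=> //.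
(* The divisor 1 supplies an index for the default value of the minimum. *)
have /codomP[i0 _] : 1%N \in codom q.
  by rewrite (perm_mem q_divisors) -dvdn_divisors.
have [A AP] := fin_all_exists
  (fun i => lower_frame_bound_ex R N_gt0 N_pd (qN i) (J_inj i) (L_gap i)).
by exists (\big[Num.min/A i0]_(i < K) A i / (p * d ^ 2)%:R), 1; apply: boundsW.
Qed.
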